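(* Every graph in the topological class $\mathcal{G}(\mathcal{L})$ of the lips tangle guarantees contiguous EF$1_{\mathrm{outer}}$ allocations for three agents who have monotone valuations.
   Context: The lips tangle corresponds to the multigraph $G_{\mathcal{L}}$ with three vertices $a,b,c$ and five edges: two parallel edges between $a$ and $b$, two parallel edges between $b$ and $c$, and one edge between $a$ and $c$. A subdivision of a multigraph is obtained by inserting zero or more new degree-$2$ vertices along its edges; the topological class $\mathcal{G}(\mathcal{L})$ is the collection of all subdivisions of $G_{\mathcal{L}}$. For a (multi)graph $G=(V,E)$ and three agents, each agent $i$ has a monotone valuation $\nu_i$ on subsets of $V$ ($\nu_i(\emptyset)=0$ and $\nu_i(X)\le\nu_i(Y)$ whenever $X\subseteq Y$). A contiguous allocation is a triple $(A_1,A_2,A_3)$ of pairwise disjoint subsets of $V$ with union $V$, each inducing a connected subgraph. It is EF$1_{\mathrm{outer}}$ if for every $i\ne j$ there is $S\subseteq A_j$ with $|S|\le 1$ such that $A_j\setminus S$ induces a connected subgraph and $\nu_i(A_i)\ge\nu_i(A_j\setminus S)$. $G$ guarantees contiguous EF$1_{\mathrm{outer}}$ allocations for three agents if such an allocation exists for every choice of monotone valuations $\nu_1,\nu_2,\nu_3$. *)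

(* Defs.v *)
From mathcomp Require Import all_boot all_order all_algebra.
From mathcomp Require Import reals.

Set Implicit Arguments.
Unset Strict Implicit.
Unset Printing Implicit Defensive.

Import Order.TTheory GRing.Theory Num.Theory.

(* Edges carry an arbitrary orientation, which is forgotten by [adj] and by
   [mgraph_iso]: the multigraphs are undirected. *)
Record mgraph := MGraph {
  vert : finType;
  edge : finType;
  ends : edge -> vert * vert
}.
Arguments ends : clear implicits.

Definition adj (G : mgraph) : rel (vert G) := fun x y =>
  [exists e : edge G, (ends G e == (x, y)) || (ends G e == (y, x))].

Definition mgraph_iso (G H : mgraph) : Prop :=
  exists (f : vert G -> vert H) (g : edge G -> edge H),
    [/\ bijective f, bijective g &
        forall e, let: (x, y) := ends G e in
          ends H (g e) = (f x, f y) \/ ends H (g e) = (f y, f x)].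

Section Subdivide.
Variables (G : mgraph) (l : edge G -> nat).

Definition subdiv_vert : finType := (vert G + {e : edge G & 'I_(l e)})%type.
Definition subdiv_edge : finType := {e : edge G & 'I_(l e).+1}.

(* The edge [e] becomes a path with [l e] inner vertices; [subdiv_point e k] is
   the [k]-th vertex of that path, for [0 <= k <= l e + 1]. *)
Definition subdiv_point (e : edge G) (k : nat) : subdiv_vert :=
  if k is k'.+1 then
    if insub k' is Some i then inr (Tagged (fun e => 'I_(l e)) (i : 'I_(l e)))
    else inl (ends G e).2
  else inl (ends G e).1.

Definition subdiv_ends (s : subdiv_edge) : subdiv_vert * subdiv_vert :=
  (subdiv_point (tag s) (tagged s), subdiv_point (tag s) (tagged s).+1).

Definition subdivide : mgraph := MGraph subdiv_ends.
End Subdivide.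

Definition topological_class (G H : mgraph) : Prop :=
  exists l : edge G -> nat, mgraph_iso (subdivide l) H.

Definition lips_ends (e : 'I_5) : 'I_3 * 'I_3 :=
  let a : 'I_3 := inord 0 in
  let b : 'I_3 := inord 1 in
  let c : 'I_3 := inord 2 in
  nth (a, a) [:: (a, b); (a, b); (b, c); (b, c); (a, c)] e.

Definition lips : mgraph := MGraph lips_ends.

(* The empty set counts as connected, so that the single vertex of a one-vertex
   bundle may be removed. *)
Definition connected_in (G : mgraph) (A : {set vert G}) : Prop :=
  forall x y, x \in A -> y \in A ->
    connect (fun u v => [&& u \in A, v \in A & adj u v]) x y.

Local Open Scope ring_scope.

Definition monotone_valuation (R : realType) (V : finType)
    (nu : {set V} -> R) : Prop :=
  nu set0 = 0 /\ forall X Y : {set V}, X \subset Y -> nu X <= nu Y.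

Definition contiguous_allocation (n : nat) (G : mgraph)
    (A : 'I_n -> {set vert G}) : Prop :=
  [/\ forall i j, i != j -> [disjoint A i & A j],
      \bigcup_i A i = [set: vert G] &
      forall i, connected_in (A i)].

Definition EF1_outer (R : realType) (n : nat) (G : mgraph)
    (nu : 'I_n -> {set vert G} -> R) (A : 'I_n -> {set vert G}) : Prop :=
  forall i j, i != j -> exists S : {set vert G},
    [/\ S \subset A j, (#|S| <= 1)%N, connected_in (A j :\: S) &
        nu i (A j :\: S) <= nu i (A i)].

Definition guarantees_EF1_outer (R : realType) (n : nat) (G : mgraph) : Prop :=
  forall nu : 'I_n -> {set vert G} -> R,
    (forall i, monotone_valuation (nu i)) ->
    exists A : 'I_n -> {set vert G},
      contiguous_allocation A /\ EF1_outer nu A.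

(* Main.v *)
Require Import Defs.
From mathcomp Require Import all_boot all_order all_algebra.
From mathcomp Require Import reals.
From mathcomp Require Import zify.

(* A discrete version of Stromquist's moving knife.  A growing bundle P eats
   the items of V one by one; the remaining items are kept in a linear order all
   of whose prefixes and suffixes are connected, and are cut at an item y where
   the agents' indifference points have their median.  An agent shouts when P is
   worth as much to her as either side of y.  When an item x passes to P, the
   median knife moves while x belongs to nobody; at the first shout, the three
   bundles obtained by handing x and y to suitable neighbours can be matched to
   the agents, x and y being the items whose removal kills the envy.

   For the lips, P first eats one a-b edge, then a, then the other a-b edge and
   the a-c edge up to b and c.  What is left is the cycle formed by the two b-c
   edges, cut at an item y and next to b or c.  It is then reordered as a path
   which starts at b or at c and in which the two sides of y are the same sets,
   and P eats this path. *)

Set Implicit Arguments.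
Unset Strict Implicit.
Unset Printing Implicit Defensive.

Import Order.TTheory GRing.Theory Num.Theory.

(** * Majorities among three agents *)

Lemma ord3_third (p q : 'I_3) : p != q -> exists r, uniq [:: p; q; r].
Proof.
case: p => -[|[|[|//]]] ip; case: q => -[|[|[|//]]] iq //= _;
  (by exists (Ordinal (isT : 0 < 3))) || (by exists (Ordinal (isT : 1 < 3)))
  || by exists (Ordinal (isT : 2 < 3)).
Qed.

Lemma ord3_other (s : 'I_3) : exists p q, uniq [:: s; p; q].
Proof.
case: s => -[|[|[|//]]] i.
- by exists (Ordinal (isT : 1 < 3)), (Ordinal (isT : 2 < 3)).
- by exists (Ordinal (isT : 0 < 3)), (Ordinal (isT : 2 < 3)).
- by exists (Ordinal (isT : 0 < 3)), (Ordinal (isT : 1 < 3)).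
Qed.

(* At least two of the three agents satisfy [A]: at most one fails to. *)
Definition maj (A : pred 'I_3) : bool :=
  [forall p, forall q, (p != q) ==> A p || A q].

Lemma majP (A : pred 'I_3) :
  reflect (forall p q, p != q -> A p || A q) (maj A).
Proof.
apply: (iffP forallP) => [h p q pq|h p].
  by have /forallP/(_ q)/implyP := h p; apply.
by apply/forallP => q; apply/implyP; apply: h.
Qed.

Lemma ord3_mem (s p q i : 'I_3) :
  uniq [:: s; p; q] -> [|| i == s, i == p | i == q].
Proof.
by case: s => -[|[|[|//]]] ?; case: p => -[|[|[|//]]] ?;
  case: q => -[|[|[|//]]] ?; case: i => -[|[|[|//]]] ?.
Qed.

(** Two agents who fail [A] leave only the third who could fail the complement. *)
Lemma majN (A : pred 'I_3) : ~~ maj A -> maj (fun i => ~~ A i).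
Proof.
rewrite /maj negb_forall => /existsP[p]; rewrite negb_forall => /existsP[q].
rewrite negb_imply negb_or => /and3P[pq Ap Aq].
have [r U] := ord3_third pq.
apply/majP => i j ij.
have := ord3_mem i U; have := ord3_mem j U.
case/or3P => /eqP ej; case/or3P => /eqP ei; subst i j;
  by rewrite ?Ap ?Aq ?orbT // eqxx in ij *.
Qed.

Lemma sub_maj (A B : pred 'I_3) : (forall i, A i -> B i) -> maj A -> maj B.
Proof.
move=> AB /majP h; apply/majP => p q /h.
by case/orP => /AB ->; rewrite ?orbT.
Qed.

(** * Vertex sequences that stay connected as they grow *)

Section Connectivity.
Variable G : mgraph.
Local Notation T := (vert G).
Implicit Types (x y : T) (s p : seq T).

Lemma adj_sym : symmetric (@adj G).
Proof. by move=> x y; apply/existsP/existsP => -[e]; exists e; rewrite orbC. Qed.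

Definition conn s := connected_in [set:: s].

Lemma conn_eq s s' : s =i s' -> conn s -> conn s'.
Proof.
move=> ss' h; rewrite /conn; suff -> : [set:: s'] = [set:: s] by [].
by apply/setP => z; rewrite !inE ss'.
Qed.

Lemma conn_nil : conn [::].
Proof. by move=> x y; rewrite inE. Qed.

Lemma conn_cons x s : s = [::] \/ has (fun y => adj y x) s -> conn s ->
  conn (x :: s).
Proof.
move=> hs cs.
pose e : rel T := fun u v => [&& u \in [set:: x :: s], v \in [set:: x :: s] & adj u v].
have esym : connect_sym e.
  apply: sym_connect_sym => u v; rewrite /e adj_sym.
  by case: (u \in _); case: (v \in _).
have cin u v : u \in s -> v \in s -> connect e u v.
  move=> us vs; have := cs u v; rewrite !inE us vs => /(_ isT isT).
  apply: connect_sub => a b /and3P[]; rewrite !inE => as_ bs ab.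
  by apply: connect1; rewrite /e !inE as_ bs ab !orbT.
have cx u : u \in s -> connect e u x.
  move=> us; case: hs => [s0|/hasP[y ys yx]]; first by rewrite s0 in us.
  apply: connect_trans (cin _ _ us ys) (connect1 _).
  by rewrite /e !inE ys yx eqxx orbT.
move=> u v; rewrite !inE => /orP[/eqP->|us] /orP[/eqP->|vs].
- exact: connect0.
- by change (connect e x v); rewrite esym cx.
- exact: cx.
- exact: cin.
Qed.

(* Every element of [s] is adjacent to [p] or to an earlier element of [s]. *)
Fixpoint attach p s :=
  if s is x :: s' then has (fun y => adj y x) p && attach (x :: p) s' else true.

Definition grow s := if s is x :: s' then attach [:: x] s' else true.

Lemma sub_attach p p' s : {subset p <= p'} -> attach p s -> attach p' s.
Proof.
elim: s p p' => [//|x s IH] p p' pp' /= /andP[/hasP[y yp yx] h].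
apply/andP; split; first by apply/hasP; exists y; rewrite ?pp'.
apply: IH h => z; rewrite !inE => /orP[->//|/pp' ->]; exact: orbT.
Qed.

Lemma attach_cat p s1 s2 :
  attach p (s1 ++ s2) = attach p s1 && attach (p ++ s1) s2.
Proof.
elim: s1 p => [|x s1 IH] p /=; first by rewrite cats0.
rewrite IH -andbA; congr [&& _, _ & _].
by apply/idP/idP; apply: sub_attach => z; rewrite !(inE, mem_cat) orbCA.
Qed.

Lemma attach_path x p s : x \in p -> path (@adj G) x s -> attach p s.
Proof.
elim: s x p => [//|y s IH] x p xp /= /andP[xy h].
apply/andP; split; first by apply/hasP; exists x.
by apply: IH h; rewrite inE eqxx.
Qed.

Lemma grow_catl s1 s2 : grow (s1 ++ s2) -> grow s1.
Proof. by case: s1 => //= x s1; rewrite attach_cat => /andP[]. Qed.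

Lemma grow_cat s1 s2 : grow s1 -> attach s1 s2 -> grow (s1 ++ s2).
Proof.
case: s1 => [_|x s1 /= h1 h2]; first by case: s2.
by rewrite attach_cat h1.
Qed.

Lemma grow_sorted s : sorted (@adj G) s -> grow s.
Proof. by case: s => //= x s; apply: attach_path; rewrite inE. Qed.

Lemma grow_conn s : grow s -> conn s.
Proof.
elim/last_ind: s => [_|s x IH]; first exact: conn_nil.
rewrite -cats1 => h.
have cs := IH (grow_catl h).
apply: (@conn_eq (x :: s)); first by move=> z; rewrite mem_cat !inE orbC.
apply: conn_cons cs; case: s h {IH} => [|y s]; first by left.
by rewrite /= attach_cat => /andP[_ /= /andP[h _]]; right.
Qed.

(** The connectivity of a bipolar numbering, for a sequence that need not exhaust the graph: a knife
    may cut it anywhere. *)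
Definition bipolar s := forall A B, s = A ++ B -> conn A /\ conn B.

(** Growth passes to prefixes, and a suffix is a prefix of the reversal. *)
Lemma grow_bipolar s : grow s -> grow (rev s) -> bipolar s.
Proof.
move=> g gr A B sAB; subst s; split; first exact: grow_conn (grow_catl g).
apply: (@conn_eq (rev B)); first by move=> z; rewrite mem_rev.
by move: gr; rewrite rev_cat => /grow_catl/grow_conn.
Qed.

(** Two branches leave the vertex [u]: the head of [t2] attaches to [u], not to the end of [t1]. *)
Lemma grow_fork w u t1 t2 : sorted (@adj G) (w ++ [:: u]) ->
  path (@adj G) u t1 -> path (@adj G) u t2 -> grow (w ++ u :: t1 ++ t2).
Proof.
move=> hw h1 h2; rewrite -cat_rcons -cats1; apply: grow_cat.
  exact: grow_sorted.
rewrite attach_cat; apply/andP; split; [apply: attach_path h1|apply: attach_path h2];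
  by rewrite !mem_cat inE eqxx !orbT.
Qed.

End Connectivity.

(** * Bundles, their cores and the agents who receive them *)

Lemma ord3_all (s p q : 'I_3) (Q : 'I_3 -> Prop) :
  uniq [:: s; p; q] -> Q s -> Q p -> Q q -> forall i, Q i.
Proof. by move=> U ? ? ? i; case/or3P: (ord3_mem i U) => /eqP->. Qed.

Lemma uniq3_neq (s p q : 'I_3) :
  uniq [:: s; p; q] -> [/\ p != s, q != s & p != q].
Proof.
rewrite /= !inE !negb_or !andbT => /andP[/andP[sp sq] pq].
by split=> //; rewrite eq_sym.
Qed.

Lemma uniq_swap (s p q : 'I_3) : uniq [:: s; p; q] -> uniq [:: s; q; p].
Proof.
rewrite /= !inE !negb_or !andbT => /andP[/andP[sp sq] pq].
by rewrite sq sp eq_sym pq.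
Qed.

Section MovingKnife.
Local Open Scope ring_scope.
Variables (R : realType) (G : mgraph) (nu : 'I_3 -> {set vert G} -> R).
Hypothesis nu_mono : forall i, monotone_valuation (nu i).
Local Notation T := (vert G).
Implicit Types (x y : T) (s P M N X : seq T) (i j p q : 'I_3).

Definition EF1_exists := exists A : 'I_3 -> {set T},
  contiguous_allocation A /\ EF1_outer nu A.

Definition val i s : R := nu i [set:: s].

Lemma val_sub i s s' : {subset s <= s'} -> val i s <= val i s'.
Proof.
move=> h; apply: (nu_mono i).2; apply/subsetP => z; rewrite !inE; exact: h.
Qed.

Lemma val_eq i s s' : s =i s' -> val i s = val i s'.
Proof. by move=> h; congr nu; apply/setP => z; rewrite !inE h. Qed.

Lemma val_nil i : val i [::] = 0.
Proof. by rewrite -(nu_mono i).1; congr nu; apply/setP => z; rewrite !inE. Qed.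

Lemma val_ge0 i s : 0 <= val i s.
Proof. by rewrite -(val_nil i) val_sub. Qed.

(* [C] is [X] up to the one item that EF1 allows to remove. *)
Definition core X C := [/\ conn X, conn C, {subset C <= X} &
  exists2 Y, (size Y <= 1)%N & {subset X <= Y ++ C}].

Lemma core_refl X : conn X -> core X X.
Proof. by move=> cX; split=> //; exists [::]. Qed.

Lemma core_cons x C : conn (x :: C) -> conn C -> core (x :: C) C.
Proof.
move=> cX cC; split=> // [z zC|]; first by rewrite inE zC orbT.
by exists [:: x].
Qed.

Lemma core_rcons x C : conn (C ++ [:: x]) -> conn C -> core (C ++ [:: x]) C.
Proof.
move=> cX cC; split=> // [z zC|]; first by rewrite mem_cat zC.
by exists [:: x] => // z; rewrite !mem_cat orbC.
Qed.

Lemma EF1_cores (s p q : 'I_3) X0 X1 X2 C0 C1 C2 :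
  uniq [:: s; p; q] -> perm_eq (X0 ++ X1 ++ X2) (enum T) ->
  core X0 C0 -> core X1 C1 -> core X2 C2 ->
  val s C1 <= val s X0 -> val s C2 <= val s X0 ->
  val p C0 <= val p X1 -> val p C2 <= val p X1 ->
  val q C0 <= val q X2 -> val q C1 <= val q X2 ->
  EF1_exists.
Proof.
move=> U perm [cX0 cC0 s0 [Y0 z0 b0]] [cX1 cC1 s1 [Y1 z1 b1]]
  [cX2 cC2 s2 [Y2 z2 b2]] *.
pose sel (Z0 Z1 Z2 : seq T) i := if i == s then Z0 else if i == p then Z1 else Z2.
have sels Z0 Z1 Z2 : sel Z0 Z1 Z2 s = Z0 by rewrite /sel eqxx.
have [/negbTE ps /negbTE qs pq] := uniq3_neq U.
have qp : (q == p) = false by rewrite eq_sym (negbTE pq).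
have selp Z0 Z1 Z2 : sel Z0 Z1 Z2 p = Z1 by rewrite /sel ps eqxx.
have selq Z0 Z1 Z2 : sel Z0 Z1 Z2 q = Z2 by rewrite /sel qs qp.
have uX : uniq (X0 ++ X1 ++ X2) by rewrite (perm_uniq perm) enum_uniq.
have disj Z Z' : uniq (Z ++ Z') -> [disjoint [set:: Z] & [set:: Z']].
  rewrite cat_uniq => /and3P[_ /hasPn h _].
  rewrite -setI_eq0; apply/eqP/setP => z; rewrite !inE.
  by apply/negP => /andP[zZ /h]; rewrite /= zZ.
have u01 : uniq (X0 ++ X1) by move: uX; rewrite catA cat_uniq => /and3P[].
have u12 : uniq (X1 ++ X2) by move: uX; rewrite cat_uniq => /and3P[].
have u02 : uniq (X0 ++ X2).
  by move: uX; rewrite uniq_catCA cat_uniq => /and3P[].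
pose A i := [set:: sel X0 X1 X2 i].
pose K i := sel C0 C1 C2 i.
have KA j : {subset K j <= sel X0 X1 X2 j}.
  by move: j; apply: (ord3_all U); rewrite /K ?sels ?selp ?selq.
have sizeY j : exists2 Y, (size Y <= 1)%N & {subset sel X0 X1 X2 j <= Y ++ K j}.
  by move: j; apply: (ord3_all U); rewrite /K ?sels ?selp ?selq; [exists Y0|exists Y1|exists Y2].
exists A; split.
  split.
  - apply: (ord3_all U); apply: (ord3_all U); rewrite /A ?sels ?selp ?selq ?eqxx // => _;
      by [exact: disj | rewrite disjoint_sym; exact: disj].
  - apply/setP => z; rewrite inE; apply/bigcupP.
    have := mem_enum T z; rewrite inE -(perm_mem perm) !mem_cat.
    by case/or3P => h; [exists s|exists p|exists q]; rewrite // /A ?sels ?selp ?selq inE.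
  - by apply: (ord3_all U); rewrite /A ?sels ?selp ?selq.
(* The removed set is the bundle minus its core, so that exactly the core remains. *)
move=> i j ij; exists (A j :\: [set:: K j]).
have -> : A j :\: (A j :\: [set:: K j]) = [set:: K j].
  rewrite setDDr setDv set0U; apply/setIidPr/subsetP => z; rewrite !inE; exact: KA.
split.
- exact: subsetDl.
- have [Y Y1' YK] := sizeY j; apply: leq_trans Y1'.
  apply: leq_trans (card_size Y); apply/subset_leq_card/subsetP => z.
  by rewrite !inE => /andP[zK /YK]; rewrite mem_cat (negbTE zK) orbF.
- by move: j {ij}; apply: (ord3_all U); rewrite /K ?sels ?selp ?selq.
- change (val i (K j) <= val i (sel X0 X1 X2 i)).
  move: j i ij; apply: (ord3_all U); apply: (ord3_all U);
    by rewrite /K ?sels ?selp ?selq ?eqxx.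
Qed.

(** * Shouts and the motion of the median knife *)

Definition shouts P M N i := (val i M <= val i P) && (val i N <= val i P).

(** The shouter takes [P]. The items [x] and [y] stand at the front of the other two bundles, and
    removing them leaves the connected cores [M] and [N]. *)
Lemma EF1_shout P x M y N (s p q : 'I_3) :
  perm_eq (P ++ (x :: M) ++ y :: N) (enum T) ->
  conn P -> bipolar (x :: M ++ y :: N) -> conn M ->
  uniq [:: s; p; q] -> shouts P M N s ->
  (val p P <= val p (x :: M)) && (val p N <= val p (x :: M)) ->
  (val q P <= val q (y :: N)) && (val q M <= val q (y :: N)) ->
  EF1_exists.
Proof.
move=> perm cP b cM U /andP[s1 s2] /andP[p1 p2] /andP[q1 q2].
have [cxM cyN] := b (x :: M) (y :: N) erefl.
have [_ cN] : conn ((x :: M) ++ [:: y]) /\ conn N by apply: b; rewrite -catA.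
apply: (EF1_cores U perm (core_refl cP) (core_cons cxM cM) (core_cons cyN cN)) => //.
Qed.

(** Hall's condition for the two agents other than [s]: each accepts a bundle, and each bundle is
    accepted by one of them. *)
Lemma EF1_shout_maj P x M y N (s : 'I_3) :
  perm_eq (P ++ (x :: M) ++ y :: N) (enum T) ->
  conn P -> bipolar (x :: M ++ y :: N) -> conn M ->
  shouts P M N s ->
  let acc1 i := (val i P <= val i (x :: M)) && (val i N <= val i (x :: M)) in
  let acc2 i := (val i P <= val i (y :: N)) && (val i M <= val i (y :: N)) in
  maj acc1 -> maj acc2 -> (forall i, acc1 i || acc2 i) -> EF1_exists.
Proof.
move=> perm cP b cM hs acc1 acc2 /majP m1 /majP m2 m12.
have [p [q U]] := ord3_other s.
have U' := uniq_swap U.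
have [_ _ pq] := uniq3_neq U.
have opt := EF1_shout perm cP b cM.
have [p1|p1] := boolP (acc1 p); have [q2|q2] := boolP (acc2 q).
- exact: opt U hs p1 q2.
- have p2 : acc2 p by have := m2 _ _ pq; rewrite (negbTE q2) orbF.
  have q1 : acc1 q by have := m12 q; rewrite (negbTE q2) orbF.
  exact: opt U' hs q1 p2.
- have p2 : acc2 p by have := m12 p; rewrite (negbTE p1).
  have q1 : acc1 q by have := m1 _ _ pq; rewrite (negbTE p1).
  exact: opt U' hs q1 p2.
- have p2 : acc2 p by have := m12 p; rewrite (negbTE p1).
  have q1 : acc1 q by have := m1 _ _ pq; rewrite (negbTE p1).
  exact: opt U' hs q1 p2.
Qed.

(** Agent [s] takes [X], and [y] goes to the side that the other two like less. If both prefer the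
    same side, the median condition provides one who accepts the other side together with [y]. *)
Lemma EF1_split X P M y N (s : 'I_3) :
  perm_eq (X ++ M ++ y :: N) (enum T) ->
  core X P -> bipolar (M ++ y :: N) ->
  val s M <= val s X -> val s N <= val s X ->
  (forall i, i != s -> (val i P <= val i M) || (val i P <= val i N)) ->
  maj (fun i => val i N <= val i (M ++ [:: y])) ->
  maj (fun i => val i M <= val i (y :: N)) -> EF1_exists.
Proof.
move=> perm cXP b sM sN hP /majP mL /majP mR.
have [cM cyN] := b M (y :: N) erefl.
have [cMy cN] : conn (M ++ [:: y]) /\ conn N by apply: b; rewrite -catA.
have permL : perm_eq (X ++ (M ++ [:: y]) ++ N) (enum T) by rewrite -catA.
have optR p q (U : uniq [:: s; p; q]) :=
  EF1_cores U perm cXP (core_refl cM) (core_cons cyN cN) sM sN.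
have optL p q (U : uniq [:: s; p; q]) :=
  EF1_cores U permL cXP (core_rcons cMy cM) (core_refl cN) sM sN.
have leN i : val i N <= val i (y :: N) by apply: val_sub => z zN; rewrite inE zN orbT.
have leM i : val i M <= val i (M ++ [:: y]) by apply: val_sub => z zN; rewrite mem_cat zN.
have Rcase p q : uniq [:: s; p; q] -> val p N <= val p M ->
    val q M <= val q (y :: N) -> EF1_exists.
  move=> U pN qM; have [ps qs _] := uniq3_neq U.
  apply: (optR p q U) => //.
    by case/orP: (hP p ps) => // /le_trans; apply.
  by case/orP: (hP q qs) => /le_trans; apply.
have Lcase p q : uniq [:: s; p; q] -> val p N <= val p (M ++ [:: y]) ->
    val q M <= val q N -> EF1_exists.
  move=> U pN qM; have [ps qs _] := uniq3_neq U.
  apply: (optL p q U) => //.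
    by case/orP: (hP p ps) => /le_trans; apply.
  by case/orP: (hP q qs) => // /le_trans; apply.
have [p [q U]] := ord3_other s.
have U' := uniq_swap U.
have [_ _ pq] := uniq3_neq U.
case: (leP (val p N) (val p M)) => hp; case: (leP (val q N) (val q M)) => hq.
- case/orP: (mR p q pq) => h; [exact: Rcase U' hq h|exact: Rcase U hp h].
- exact: Rcase U hp (le_trans (ltW hq) (leN q)).
- exact: Rcase U' hq (le_trans (ltW hp) (leN p)).
- case/orP: (mL p q pq) => h; [exact: Lcase U h (ltW hq)|exact: Lcase U' h (ltW hp)].
Qed.

(* [y] is the item under the median knife. *)
Definition quiet_median P s := exists M y N, [/\ s = M ++ y :: N,
  maj (fun i => val i N <= val i (M ++ [:: y])),
  maj (fun i => val i M <= val i (y :: N)) & forall i, ~~ shouts P M N i].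

Lemma shoutsN P M N i : ~~ shouts P M N i ->
  (val i P < val i M) || (val i P < val i N).
Proof. by rewrite negb_and -!ltNge. Qed.

(** The knife is at a median of what remains, so [x] may join [P]. If this causes a shout, the
    shouter takes [P ++ [:: x]], where the others envy at most the core [P]. *)
Lemma median_end P x M y N :
  perm_eq (P ++ x :: M ++ y :: N) (enum T) ->
  conn P -> conn (P ++ [:: x]) -> bipolar (M ++ y :: N) ->
  maj (fun i => val i N <= val i (M ++ [:: y])) ->
  maj (fun i => val i M <= val i (y :: N)) ->
  (forall i j, shouts P M N i -> j != i -> ~~ shouts P M N j) ->
  EF1_exists \/ quiet_median (P ++ [:: x]) (M ++ y :: N).
Proof.
move=> perm cP cPx b mL mR hs.
have [i hi|quiet] := pickP (shouts (P ++ [:: x]) M N); last first.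
  by right; exists M, y, N; split=> // i; rewrite quiet.
left.
have lePx k : val k P <= val k (P ++ [:: x]).
  by apply: val_sub => z zP; rewrite mem_cat zP.
(* An agent who shouts already at [P] takes precedence, so that the other two are quiet at [P]. *)
have [s /andP[sM sN] hsu] : exists2 s, shouts (P ++ [:: x]) M N s &
    forall j, j != s -> ~~ shouts P M N j.
  have [s hs'|quiet] := pickP (shouts P M N); last first.
    by exists i => // j _; rewrite quiet.
  exists s; last by move=> j; apply: hs.
  by case/andP: hs' => h1 h2; apply/andP; split; apply: le_trans (lePx s).
apply: (@EF1_split _ P M y N s _ (core_rcons cPx cP) b) => //.
  by rewrite -catA.
by move=> j /hsu/shoutsN /orP[] /ltW ->; rewrite ?orbT.
Qed.

(* [x] has left the remaining items but has not reached [P]; the knife moves from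
   [y] to the next median.  A shouter who has made no allocation possible is
   unique, and would also accept [x :: M]. *)
Lemma median_walk P x N M y :
  perm_eq (P ++ x :: M ++ y :: N) (enum T) ->
  conn P -> conn (P ++ [:: x]) -> bipolar (x :: M ++ y :: N) -> bipolar (M ++ y :: N) ->
  maj (fun i => val i M <= val i (y :: N)) ->
  maj (fun i => (val i P <= val i (x :: M ++ [:: y])) &&
                (val i N <= val i (x :: M ++ [:: y]))) ->
  (forall i, shouts P M N i ->
     (val i P <= val i (x :: M)) && (val i N <= val i (x :: M)) /\
     forall j, j != i -> ~~ shouts P M N j) ->
  EF1_exists \/ quiet_median (P ++ [:: x]) (M ++ y :: N).
Proof.
elim: N M y => [|z N IH] M y perm cP cPx b b' mR mL hs.
  apply: median_end => //; last by move=> i j /hs[_]; apply.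
  by apply/majP => i j _; rewrite val_nil val_ge0.
have [mL'|] := boolP (maj (fun i => val i (z :: N) <= val i (M ++ [:: y]))).
  by apply: median_end => // i j /hs[_]; apply.
(* A strict majority for the right side sends the knife on to [z]. *)
move/majN => mR'.
have eqMyz : M ++ [:: y, z & N] = (M ++ [:: y]) ++ z :: N by rewrite -catA.
rewrite eqMyz in perm b b' *; set M' := M ++ [:: y] in mL mR' perm b b' *.
have leM i : val i M <= val i M' by apply: val_sub => t tM; rewrite mem_cat tM.
have leMx i : val i M' <= val i (x :: M') by apply: val_sub => t tM; rewrite inE tM orbT.
have lexM i : val i (x :: M) <= val i (x :: M').
  by apply: val_sub => t; rewrite /M' !(inE, mem_cat) => /orP[]->; rewrite ?orbT.
have leN i : val i N <= val i (z :: N) by apply: val_sub => t tN; rewrite inE tN orbT.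
have mR2 : maj (fun i => val i M' <= val i (z :: N)).
  by apply: sub_maj mR' => i; rewrite -ltNge => /ltW.
have [cM' _] := b' M' (z :: N) erefl.
have mL2 : maj (fun i => (val i P <= val i (x :: M')) &&
                (val i N <= val i (x :: M'))).
  by apply: sub_maj mL => i /andP[-> /(le_trans (leN i)) ->].
have mL3 : maj (fun i => (val i P <= val i (x :: M' ++ [:: z])) &&
                (val i N <= val i (x :: M' ++ [:: z]))).
  apply: sub_maj mL2 => i /andP[h1 h2].
  have le2 : val i (x :: M') <= val i (x :: M' ++ [:: z]).
    by apply: val_sub => t; rewrite -cat_cons mem_cat => ->.
  by rewrite (le_trans h1 le2) (le_trans h2 le2).
have accN i : ~~ shouts P M (z :: N) i -> val i M' <= val i (z :: N) ->
    (val i P <= val i (z :: N)) && (val i M' <= val i (z :: N)).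
  move=> /shoutsN hi h; rewrite h andbT.
  by case/orP: hi => /ltW // /le_trans; apply; apply: le_trans h.
have accM i : ~~ shouts P M (z :: N) i -> val i (z :: N) <= val i M' ->
    (val i P <= val i (x :: M')) && (val i N <= val i (x :: M')).
  move=> /shoutsN hi h; rewrite (le_trans (leN i) (le_trans h (leMx i))) andbT.
  by apply: le_trans (leMx i); case/orP: hi => /ltW /le_trans; apply.
have [t ht|quiet'] := pickP (shouts P M' N); last first.
  by apply: IH => // i; rewrite quiet'.
have [s hs'|quiet] := pickP (shouts P M (z :: N)); last first.
  have nq i : ~~ shouts P M (z :: N) i by rewrite quiet.
  left; apply: (EF1_shout_maj perm cP b cM' ht mL2).
    by apply: sub_maj mR2 => i; apply: accN.
  move=> i; case: (leP (val i (z :: N)) (val i M')) => h.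
    by rewrite (accM i).
  by rewrite (accN i) ?orbT // ltW.
have [/andP[sP sN] su] := hs s hs'.
have accs : (val s P <= val s (x :: M')) && (val s N <= val s (x :: M')).
  by rewrite (le_trans sP (lexM s)) (le_trans (leN s) (le_trans sN (lexM s))).
(* A new shouter [r] besides the old shouter [s] yields an allocation. If the third agent [q]
   prefers [z :: N], she takes it, [r] takes [P] and [s] takes [x :: M']. Otherwise [s] and [r] form
   the strict majority for [z :: N], so [s] still shouts, and [P], [x :: M'], [z :: N] go to [s],
   [q], [r]. *)
have [r /andP[rs hr]|others] := pickP (fun r => (r != s) && shouts P M' N r).
  left; have sr : s != r by rewrite eq_sym.
  have [q U] := ord3_third sr.
  have [_ qs rq] := uniq3_neq U.
  have nq := su q qs.
  case: (leP (val q (z :: N)) (val q M')) => h; last first.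
    have U' : uniq [:: r; s; q].
      by rewrite /= !inE negb_or rs rq eq_sym qs.
    exact: (EF1_shout perm cP b cM' U' hr accs (accN q nq (ltW h))).
  have hM i : i != q -> val i M' < val i (z :: N).
    move=> iq; move/majP: mR' => /(_ i q iq) /orP[|]; last by rewrite h.
    by rewrite -ltNge.
  case/andP: hs' => sM' sN'.
  have shs : shouts P M' N s.
    apply/andP; split; last exact: le_trans (leN s) sN'.
    by apply: le_trans sN'; apply/ltW/hM; rewrite eq_sym.
  exact: (EF1_shout perm cP b cM' (uniq_swap U) shs (accM q nq h)
    (accN r (su r rs) (ltW (hM r rq)))).
apply: IH => // i hi; have : i = s.
  by apply/eqP; have := others i; rewrite hi andbT => /negbFE.
move=> ei; subst i; split=> // j js.
by have := others j; rewrite js /= => ->.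
Qed.

Lemma quiet_median_step P x s :
  perm_eq (P ++ x :: s) (enum T) -> conn P -> conn (P ++ [:: x]) ->
  bipolar (x :: s) -> bipolar s ->
  quiet_median P (x :: s) -> EF1_exists \/ quiet_median (P ++ [:: x]) s.
Proof.
move=> perm cP cPx b b' [M [y [N [E mL mR quiet]]]].
(* Either [x] is itself under the knife, which jumps to the next item, or [x] leaves the left side
   and the knife starts from the same [y]. *)
case: M E mL mR quiet => [[? ?]|x' M [? ?]] mL mR quiet.
  subst y N; case: s perm b b' mL mR quiet => [|y N] perm b b' mL mR quiet.
    by have /shoutsN := quiet ord0; rewrite val_nil !ltNge val_ge0.
  have ltP i : val i P < val i (y :: N).
    have /shoutsN := quiet i; rewrite val_nil => /orP[|//].
    by rewrite ltNge val_ge0.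
  have leN i : val i N <= val i (y :: N) by apply: val_sub => t tN; rewrite inE tN orbT.
  have mL2 : maj (fun i => (val i P <= val i [:: x]) && (val i N <= val i [:: x])).
    apply: sub_maj mL => i h.
    by rewrite (le_trans (leN i) h) andbT (le_trans (ltW (ltP i)) h).
  have acc2 i : (val i P <= val i (y :: N)) && (val i [::] <= val i (y :: N)).
    by rewrite ltW // val_nil val_ge0.
  have [t ht|quiet'] := pickP (shouts P [::] N).
    left; apply: (@EF1_shout_maj P x [::] y N t perm cP b (@conn_nil G) ht mL2) => [|i].
      by apply/majP => i j _; rewrite acc2.
    by rewrite acc2 orbT.
  apply: (@median_walk P x N [::] y) => //.
  - by apply/majP => i j _; rewrite val_nil val_ge0.
  - apply: sub_maj mL2 => i /andP[h1 h2].
    have le2 : val i [:: x] <= val i [:: x; y].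
      by apply: val_sub => t; rewrite !inE => ->.
    by rewrite /= (le_trans h1 le2) (le_trans h2 le2).
  - by move=> i; rewrite quiet'.
subst x' s.
have leM i : val i M <= val i (x :: M) by apply: val_sub => t tN; rewrite inE tN orbT.
have lexM i : val i (x :: M) <= val i (x :: M ++ [:: y]).
  by apply: val_sub => t; rewrite -cat_cons mem_cat => ->.
have leN i : val i N <= val i (y :: N) by apply: val_sub => t tN; rewrite inE tN orbT.
have [cM _] := b' M (y :: N) erefl.
have acc1 i : val i N <= val i (x :: M) ->
    (val i P <= val i (x :: M)) && (val i N <= val i (x :: M)).
  move=> h; rewrite h andbT; have /shoutsN := quiet i.
  by case/orP => /ltW // /le_trans; apply.
have acc2 i : val i (x :: M) <= val i (y :: N) ->
    (val i P <= val i (y :: N)) && (val i M <= val i (y :: N)).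
  move=> h; rewrite (le_trans (leM i) h) andbT; have /shoutsN := quiet i.
  by case/orP => /ltW /le_trans; apply.
have go : (forall i, shouts P M N i -> val i N <= val i (x :: M) /\
     forall j, j != i -> ~~ shouts P M N j) ->
    EF1_exists \/ quiet_median (P ++ [:: x]) (M ++ y :: N).
  move=> hs; apply: median_walk => //.
  - by apply: sub_maj mR => i; apply: le_trans.
  - apply: sub_maj mL => i h; rewrite h andbT; have /shoutsN := quiet i.
    by case/orP => /ltW /le_trans; apply.
  - by move=> i /hs[/acc1 ? ?].
have [t ht|quiet'] := pickP (shouts P M N); last by apply: go => i; rewrite quiet'.
(* A shouter was quiet before [x] left only because [x :: M] beat [P]. Two such agents would make a
   majority for [x :: M] over [N], so without that majority the shouter is unique. *)
have shN i : shouts P M N i -> val i N < val i (x :: M).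
  move=> /andP[_ h]; have /shoutsN := quiet i.
  by rewrite [_ < val i N]ltNge h orbF; apply: le_lt_trans.
have [mm|/majN mm] := boolP (maj (fun i => val i N <= val i (x :: M))).
  left; apply: (EF1_shout_maj perm cP b cM ht).
  - by apply: sub_maj mm => i; apply: acc1.
  - by apply: sub_maj mR => i; apply: acc2.
  - move=> i; case: (leP (val i N) (val i (x :: M))) => h; apply/orP.
      by left; have /andP[->] := acc1 i h.
    by right; apply: acc2; apply: le_trans (ltW h) (leN i).
apply: go => i hi; split; first exact/ltW/shN.
move=> j ji; apply/negP => hj; have /majP/(_ j i ji) := mm.
by rewrite !ltW ?shN.
Qed.

(** * The initial median and sweeps of the growing bundle *)

Lemma quiet_median_exists s : s != [::] -> perm_eq s (enum T) -> bipolar s ->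
  EF1_exists \/ quiet_median [::] s.
Proof.
move=> s0 perm b.
have [M [y [N [E mL mR]]]] : exists M y N, [/\ s = M ++ y :: N,
    maj (fun i => val i N <= val i (M ++ [:: y])) &
    maj (fun i => val i M <= val i (y :: N))].
  (* The knife moves right until [N] no longer has a strict majority over [M ++ [:: y]]. *)
  have scan N : forall M y, maj (fun i => val i M <= val i (y :: N)) ->
      exists M' y' N', [/\ M ++ y :: N = M' ++ y' :: N',
      maj (fun i => val i N' <= val i (M' ++ [:: y'])) &
      maj (fun i => val i M' <= val i (y' :: N'))].
    elim: N => [|z N IH] M y mR.
      exists M, y, [::]; split=> //.
      by apply/majP => i j _; rewrite val_nil val_ge0.
    have [mL|/majN mL] := boolP (maj (fun i => val i (z :: N) <= val i (M ++ [:: y]))).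
      by exists M, y, (z :: N).
    have [|M' [y' [N' [E ? ?]]]] := IH (M ++ [:: y]) z.
      by apply: sub_maj mL => i; rewrite -ltNge => /ltW.
    by exists M', y', N'; split=> //; rewrite -E -catA.
  case: s s0 {perm b} => // y N _; apply: (scan N [::]).
  by apply/majP => i j _; rewrite val_nil val_ge0.
have [i /andP[iM iN]|quiet] := pickP (shouts [::] M N); last first.
  by right; exists M, y, N; split=> // i; rewrite quiet.
(* An agent who shouts at the empty bundle values both sides at 0 and can be given nothing. *)
left; subst s; apply: (@EF1_split [::] [::] M y N i) => //.
- exact/core_refl/conn_nil.
- by move=> j _; rewrite val_nil val_ge0.
Qed.

Lemma quiet_median_rev P s : quiet_median P s -> quiet_median P (rev s).
Proof.
move=> [M [y [N [-> mL mR quiet]]]]; exists (rev N), y, (rev M).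
have eqr (A : seq T) i : val i (rev A) = val i A by apply: val_eq => z; rewrite mem_rev.
split.
- by rewrite rev_cat rev_cons cat_rcons.
- apply: sub_maj mR => i; rewrite eqr => /le_trans; apply.
  by apply: val_sub => z; rewrite mem_cat !inE mem_rev orbC.
- apply: sub_maj mL => i; rewrite eqr => /le_trans; apply.
  by apply: val_sub => z; rewrite mem_cat !inE mem_rev orbC.
- by move=> i; rewrite /shouts !eqr andbC; apply: quiet.
Qed.

(** Eating from the front cuts the end of the reversed order, so one growth condition on the
    reversal serves all steps; the forward order needs one for each suffix. *)
Lemma sweep P s1 s2 :
  perm_eq (P ++ s1 ++ s2) (enum T) -> grow (P ++ s1) ->
  (forall A B, s1 = A ++ B -> grow (B ++ s2)) -> grow (rev (s1 ++ s2)) ->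
  quiet_median P (s1 ++ s2) -> EF1_exists \/ quiet_median (P ++ s1) s2.
Proof.
elim: s1 P => [|x s1 IH] P perm gP g gr q; first by right; rewrite cats0.
have gr' : grow (rev (s1 ++ s2)).
  by move: gr; rewrite cat_cons rev_cons -cats1 => /grow_catl.
have gPx : grow ((P ++ [:: x]) ++ s1) by rewrite -catA.
have [|||||||q'] := @quiet_median_step P x (s1 ++ s2) => //; try by left.
- exact: grow_conn (grow_catl gP).
- exact: grow_conn (grow_catl gPx).
- by apply: grow_bipolar gr; apply: (g [::]).
- by apply: grow_bipolar gr'; apply: (g [:: x]).
have [] := IH (P ++ [:: x]) _ gPx _ gr' q'.
- by rewrite -catA.
- by move=> A B E; apply: (g (x :: A)); rewrite E.
- by left.
- by rewrite -catA; right.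
Qed.

Lemma quiet_median_nil P : ~ quiet_median P [::].
Proof. by case=> -[|? ?] [? [? []]]. Qed.

End MovingKnife.

Lemma cat_eq_cons (T : Type) (s1 s2 M N : seq T) y : s1 ++ s2 = M ++ y :: N ->
  (exists2 N1, s1 = M ++ y :: N1 & N = N1 ++ s2) \/
  (exists2 M1, s2 = M1 ++ y :: N & M = s1 ++ M1).
Proof.
elim: s1 M => [|x s1 IH] [|x' M] /=; try by right; exists [::].
- by move=> ->; right; exists (x' :: M).
- by case=> -> <-; left; exists s1.
- by case=> -> /IH[[N1 -> ->]|[M1 -> ->]]; [left; exists N1|right; exists M1].
Qed.

(** * Orders of the vertices of a subdivided lips graph *)

Section LipsSubdivision.
Variables (R : realType) (G : mgraph) (nu : 'I_3 -> {set vert G} -> R).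
Hypothesis nu_mono : forall i, monotone_valuation (nu i).
Local Notation T := (vert G).
Local Notation walk := (path (@adj G)).

Lemma walk_rev (x y : T) s :
  walk x (rcons s y) -> walk y (rcons (rev s) x).
Proof.
move=> h; have := rev_path (@adj G) x (rcons s y).
rewrite last_rcons belast_rcons rev_cons => ->.
by rewrite (eq_path (e' := @adj G)) // => u v; rewrite adj_sym.
Qed.

Lemma sorted_adj_rev (s : seq T) : sorted (@adj G) s -> sorted (@adj G) (rev s).
Proof.
by rewrite rev_sorted (eq_sorted (e' := @adj G)) // => u v; rewrite adj_sym.
Qed.

(** Once [P] has eaten everything there is no item to hold the knife, so the sweep must have
    produced an allocation. *)
Lemma EF1_traceable P s (u : T) : quiet_median nu P s ->
  perm_eq (P ++ s) (enum T) -> grow P -> u \in P -> walk u s -> EF1_exists nu.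
Proof.
move=> q perm gP uP ws; have ss := path_sorted ws.
have [|||||//|] := @sweep R G nu nu_mono P s [::].
- by rewrite cats0.
- by apply: grow_cat gP _; apply: attach_path ws.
- by move=> A B E; rewrite cats0; move: ss; rewrite E => /cat_sorted2[_ /grow_sorted].
- by rewrite cats0; apply/grow_sorted/sorted_adj_rev.
- by rewrite cats0.
- by move/quiet_median_nil.
Qed.

Lemma lips_EF1 (a b c : T) (l1 l2 l3 l4 l5 : seq T) :
  walk b (rcons l1 a) -> walk a (rcons l2 b) ->
  walk b (rcons l3 c) -> walk b (rcons l4 c) -> walk c (rcons l5 a) ->
  perm_eq ((l1 ++ a :: l2) ++ b :: l3 ++ l4 ++ c :: l5) (enum T) ->
  EF1_exists nu.
Proof.
move=> p1 p2 p3 p4 p5 perm.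
have pre x s (y : T) : walk x (rcons s y) -> walk x s.
  by rewrite rcons_path => /andP[].
have q3 := walk_rev p3; have q4 := walk_rev p4; have q5 := walk_rev p5.
have glue x s (y : T) s' : walk x (rcons s y) -> walk y s' -> walk x (s ++ y :: s').
  by rewrite -cat_rcons cat_path last_rcons => -> ->.
have suf x w (u : T) A B t1 t2 : walk x (rcons w u) -> w = A ++ B ->
    walk u t1 -> walk u t2 -> grow (B ++ u :: t1 ++ t2).
  move=> /path_sorted + E; rewrite E rcons_cat => /cat_sorted2[_ hB].
  by apply: grow_fork; rewrite cats1.
set P1 := l1 ++ a :: l2 in perm *; set z := b :: _ in perm *.
have w1 : walk b (rcons P1 b) by rewrite /P1 rcons_cat rcons_cons; apply: glue.
have gz A B : P1 = A ++ B -> grow (B ++ z).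
  by move=> E; exact: (suf _ _ _ _ _ _ _ w1 E (pre _ _ _ p3) (glue _ _ _ _ p4 (pre _ _ _ p5))).
set z2 := c :: rev l4 ++ rev l3 ++ [:: b].
have rz : rev z = rev l5 ++ z2.
  by rewrite /z /z2 !(rev_cat, rev_cons) -!cats1 -!catA.
(* With [t] empty this serves the remainder [z2], with [t] equal to [rev P1] the whole reversed
   order. *)
have gz2 t A B : walk b t -> rev l5 = A ++ B -> grow (B ++ c :: rev l4 ++ rev l3 ++ b :: t).
  by move=> wt E; exact: (suf _ _ _ _ _ _ _ q5 E (pre _ _ _ q4) (glue _ _ _ _ q3 wt)).
have [|| //|q] := @quiet_median_exists R G nu nu_mono (P1 ++ z) _ perm.
- by case: (P1).
- apply: grow_bipolar; first exact: (gz [::]).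
  rewrite rev_cat rz /z2 -!catA /= -!catA; apply: (gz2 _ [::]) => //.
  exact/(pre _ _ _ (walk_rev w1)).
have [|| //|{}q] := @sweep R G nu nu_mono [::] P1 z perm _ gz _ q.
- exact/grow_sorted/path_sorted/(pre _ _ _ w1).
- rewrite rev_cat rz /z2 -!catA /= -!catA; apply: (gz2 _ [::]) => //.
  exact/(pre _ _ _ (walk_rev w1)).
(* The remaining order is turned around so that the a-c edge is eaten from its end at [a]. *)
have {}q := quiet_median_rev nu_mono q; rewrite rz in q.
have gP2 : grow (P1 ++ rev l5).
  (* The eaten part forks at [a] into [l2] and [rev l5]. *)
  rewrite /P1 -catA cat_cons.
  exact: (@suf b l1 a [::] l1 _ _ p1 erefl (pre _ _ _ p2) (pre _ _ _ q5)).
have [||| //|{}q] := @sweep R G nu nu_mono P1 (rev l5) z2 _ gP2 _ _ q.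
- by rewrite -rz; apply: perm_trans perm; rewrite perm_cat2l perm_rev.
- by move=> A B; apply: gz2.
- by rewrite -rz revK; apply: (gz P1 [::]); rewrite cats0.
set P2 := P1 ++ rev l5 in gP2 q *; have {}q := quiet_median_rev nu_mono q.
have rz2 : rev z2 = (b :: l3) ++ (l4 ++ [:: c]).
  by rewrite /z2 !(rev_cat, rev_cons, revK) -!cats1 /= -!catA.
case: q; rewrite rz2 => M [y [N [E mL mR quiet]]].
have permP s : perm_eq s (b :: l3 ++ l4 ++ [:: c]) -> perm_eq (P2 ++ s) (enum T).
  move=> h; apply: perm_trans perm; rewrite /P2 -[(P1 ++ _) ++ s]catA perm_cat2l perm_catC.
  have -> : z = (b :: l3 ++ l4 ++ [:: c]) ++ l5 by rewrite /z /= -!catA.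
  by apply: perm_cat => //; rewrite perm_rev.
(* If [y] lies on [b :: l3], the right part is also an arc of the path
   b l3 c (rev l4); otherwise the left part is an arc of (rev l3) b l4 c. *)
case: (cat_eq_cons E) => [[N1 E1 EN]|[M1 E1 EM]].
  (* [P2] reaches [b] from the last vertex of [l2], or from [a] if [l2] is empty. *)
  apply: (@EF1_traceable P2 (b :: l3 ++ c :: rev l4) (last a l2)) => //.
  - have eN : N =i N1 ++ c :: rev l4.
      by move=> t; rewrite EN !(mem_cat, inE) mem_rev [_ || (t == c)]orbC.
    exists M, y, (N1 ++ c :: rev l4); split.
    + by rewrite -cat_cons E1 -catA.
    + by apply: sub_maj mL => i; rewrite (val_eq nu i eN).
    + apply: sub_maj mR => i; rewrite (@val_eq _ _ nu i (y :: N) (y :: N1 ++ c :: rev l4)) //.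
      by move=> t; rewrite inE eN inE.
    + by move=> i; rewrite /shouts -(val_eq nu i eN); apply: quiet.
  - apply: permP; rewrite perm_cons perm_cat2l -cat1s perm_catC perm_cat2r.
    by rewrite perm_rev.
  - by rewrite /P2 /P1 !mem_cat mem_last orbT.
  - have : walk a (l2 ++ b :: l3 ++ c :: rev l4).
      by apply: (glue _ _ _ _ p2); apply: (glue _ _ _ _ p3); apply: (pre _ _ _ q4).
    by rewrite cat_path => /andP[].
have eM : M =i rev l3 ++ b :: M1.
  by move=> t; rewrite EM !(mem_cat, inE) mem_rev orbCA orbA.
have eo : rev (c :: rev l4 ++ b :: l3) = rev l3 ++ b :: l4 ++ [:: c].
  by rewrite rev_cons rev_cat rev_cons revK -!cats1 -!catA.
(* Likewise [c] is reached from the end of [rev l5], or from [a]. *)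
apply: (@EF1_traceable P2 (c :: rev l4 ++ b :: l3) (last a (rev l5))) => //.
- rewrite -[c :: _]revK eo; apply: quiet_median_rev => //.
  exists (rev l3 ++ b :: M1), y, N; split.
  + by rewrite E1 -catA.
  + apply: sub_maj mL => i.
    rewrite (@val_eq _ _ nu i (M ++ [:: y]) ((rev l3 ++ b :: M1) ++ [:: y])) //.
    by move=> t; rewrite !(mem_cat _ _ [:: y]) eM.
  + by apply: sub_maj mR => i; rewrite (val_eq nu i eM).
  + by move=> i; rewrite /shouts -(val_eq nu i eM); apply: quiet.
- apply: permP; rewrite -cat_cons perm_catC /= perm_cons perm_cat2l.
  by rewrite -cat1s perm_catC perm_cat2r perm_rev.
- have := mem_last a (rev l5); rewrite /P2 /P1 !(mem_cat, inE).
  by case/orP => ->; rewrite ?orbT.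
- have : walk a (rev l5 ++ c :: rev l4 ++ b :: l3).
    by apply: (glue _ _ _ _ q5); apply: (glue _ _ _ _ q4); apply: (pre _ _ _ p3).
  by rewrite cat_path => /andP[].
Qed.
End LipsSubdivision.

(** * Edges of a subdivided multigraph as paths *)

Section Subdivision.
Variables (H G : mgraph) (l : edge H -> nat) (f : subdiv_vert l -> vert G).
Variable g : subdiv_edge l -> edge G.
Hypothesis fg : forall e, let: (x, y) := subdiv_ends e in
  ends G (g e) = (f x, f y) \/ ends G (g e) = (f y, f x).

Definition inner_path (k : edge H) : seq (vert G) :=
  [seq f (subdiv_point l k j) | j <- iota 1 (l k)].

(** The index [l k] lies outside ['I_(l k)], so [insub] fails and the default is the second end. *)
Lemma subdiv_point_last k : subdiv_point l k (l k).+1 = inl (ends H k).2.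
Proof. by rewrite /= insubF ?ltnn. Qed.

Lemma adj_subdiv_point k j : j < (l k).+1 ->
  adj (f (subdiv_point l k j)) (f (subdiv_point l k j.+1)).
Proof.
move=> jl; pose e : subdiv_edge l := Tagged (fun k => 'I_(l k).+1) (Ordinal jl).
apply/existsP; exists (g e).
by case: (fg e) => ->; rewrite eqxx ?orbT.
Qed.

Lemma walk_inner_path k :
  path (@adj G) (f (inl (ends H k).1)) (rcons (inner_path k) (f (inl (ends H k).2))).
Proof.
have main n : forall j, j + n <= (l k).+1 -> path (@adj G)
    (f (subdiv_point l k j)) [seq f (subdiv_point l k i) | i <- iota j.+1 n].
  elim: n => [//|n IH] j; rewrite addnS -addSn => h; apply/andP; split.
    by apply: adj_subdiv_point; apply: leq_trans h; rewrite ltnS leq_addr.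
  exact: IH h.
have iotaS : iota 1 (l k).+1 = rcons (iota 1 (l k)) (l k).+1.
  by rewrite -cats1 -[X in iota 1 X]addn1 iotaD add1n.
by have := main _ 0 (leqnn _); rewrite iotaS map_rcons subdiv_point_last.
Qed.

Lemma mem_inner_path k (i : 'I_(l k)) :
  f (inr (Tagged (fun k => 'I_(l k)) i)) \in inner_path k.
Proof.
(* Point 0 is the first end, hence the shift by one. *)
apply/mapP; exists i.+1; first by rewrite mem_iota /= add1n ltnS ltn_ord.
by rewrite /= insubT //= => ?; congr (f (inr (Tagged _ _))); apply: val_inj.
Qed.

End Subdivision.

Theorem theorem8p1 (R : realType) (G : mgraph) (hG : topological_class lips G) :
  guarantees_EF1_outer R 3 G.
Proof.
case: hG => l [f [g [bf _ fg]]] nu nu_mono.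
change (EF1_exists nu).
have w k := walk_inner_path fg k.
pose o k (h : k < 5) : edge lips := Ordinal h.
pose k0 := o 0 isT; pose k1 := o 1 isT; pose k2 := o 2 isT.
pose k3 := o 3 isT; pose k4 := o 4 isT.
pose vtx n := f (inl (inord n : 'I_3)).
(* Edges of [lips] run from the smaller to the larger index, so edges 0 and 4 are traversed
   backwards to arrive at [a]. *)
apply: (@lips_EF1 R G nu nu_mono (vtx 0) (vtx 1) (vtx 2) _ _ _ _ _
  (walk_rev (w k0)) (w k1) (w k2) (w k3) (walk_rev (w k4))).
set s := _ ++ _.
have in_s t : t \in s = [|| t \in [:: vtx 0; vtx 1; vtx 2], t \in inner_path f k0,
    t \in inner_path f k1, t \in inner_path f k2, t \in inner_path f k3
    | t \in inner_path f k4].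
  rewrite /s !(mem_cat, inE, mem_rev).
  by do 3! case: (t == _); do 5! case: (t \in _).
have cover t : t \in s.
  have [f' _ f'K] := bf; rewrite -(f'K t) in_s; case: (f' t) => [v|[k i]].
    have -> : f (inl v) = vtx v by rewrite /vtx inord_val.
    by case: v => -[|[|[|//]]] iv; rewrite !inE eqxx ?orbT.
  have : k \in [:: k0; k1; k2; k3; k4].
    by case: k {i} => -[|[|[|[|[|//]]]]] ik; rewrite !inE.
  have := mem_inner_path f i; move: (f _) => u uk.
  rewrite !inE => /or4P[| | |/orP[]] /eqP ek; rewrite ek in uk;
    by rewrite uk ?orbT.
apply: uniq_perm; [|exact: enum_uniq|by move=> t; rewrite cover mem_enum].
(* A list that covers all vertices and is no longer than their number has no repetition. *)
apply: (@leq_size_uniq _ (enum (vert G))); first exact: enum_uniq.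
  by move=> t _; apply: cover.
rewrite -cardE -(bij_eq_card bf) card_sum card_ord card_tagged sumnE big_map big_enum /=.
have -> : \sum_(k in 'I_5) #|'I_(l k)| = l k0 + (l k1 + (l k2 + (l k3 + l k4))).
  rewrite (eq_bigl predT) // !big_ord_recl big_ord0 !card_ord addn0.
  by congr (l _ + (l _ + (l _ + (l _ + l _)))); apply: val_inj.
rewrite /s !size_cat /= !size_cat /= !size_rev !size_map !size_iota; lia.
Qed.
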